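(* Let $(\xi_i)_{i\in\mathbb{N}}$ be an exchangeable sequence of real-valued random variables with finite moments of all orders, with de Finetti representation $(T,\mathcal{T},\mu)$, $\Lambda$, variances $v(\tau)$, and let $\nu$ be the push forward of $\mu$ under $\tau\mapsto v(\tau)$. Let $\sigma_\mu$ be the Borel probability measure on $\mathbb{R}$ defined by $\int f\,d\sigma_\mu=\int_T\int f\,d\sigma_{v(\tau)}\,d\mu(\tau)$ for all bounded continuous $f:\mathbb{R}\to\mathbb{R}$. Then $\sigma_\mu$ is a semicircle (i.e. $\sigma_\mu=\sigma_s$ for some $s\in[0,\infty)$) if and only if there exists $a\in[0,\infty)$ such that $\nu=\delta_a$.
   Context: An infinite sequence $(\xi_i)_{i\in\mathbb{N}}$ of real random variables is exchangeable if for every $n$ and every permutation $\pi$ of $\{1,\dots,n\}$ the vectors $(\xi_1,\dots,\xi_n)$ and $(\xi_{\pi(1)},\dots,\xi_{\pi(n)})$ have the same distribution. De Finetti representation: there are a probability space $(T,\mathcal{T},\mu)$ and a measurable map $\Lambda:T\to\mathcal{M}_1(\mathbb{R})$, $\tau\mapsto\Lambda_\tau$, into the space of Borel probability measures on $\mathbb{R}$ (with the topology of weak convergence) such that $\mathbb{P}((\xi_i)_i\in F)=\int_T P_{\Lambda_\tau}(F)\,d\mu(\tau)$ for all measurable $F\subset\mathbb{R}^{\mathbb{N}}$, where $P_\lambda$ denotes the infinite product measure $\bigotimes_{i\in\mathbb{N}}\lambda$ on $\mathbb{R}^{\mathbb{N}}$. By convention the representation is chosen such that all moments of $\Lambda_\tau$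 are finite for every $\tau\in T$. Put $m_k(\tau):=\int x^k\,d\Lambda_\tau(x)$ and $v(\tau):=m_2(\tau)-m_1(\tau)^2\geq 0$. For $v>0$, $\sigma_v$ is the probability measure on $\mathbb{R}$ with Lebesgue density $\frac{1}{2\pi v}\sqrt{(4v-x^2)_+}$, where $g_+=\max(g,0)$; $\sigma_0:=\delta_0$ (Dirac measure at $0$), which is also called a semicircle. *)

(* Defs.v *)
From HB Require Import structures.
From mathcomp Require Import all_boot all_order all_algebra.
From mathcomp Require Import perm.
From mathcomp Require Import all_classical all_reals all_analysis.
From mathcomp Require Import measurable_realfun.

Set Implicit Arguments.
Unset Strict Implicit.
Unset Printing Implicit Defensive.

Import Order.TTheory GRing.Theory Num.Theory.
Import numFieldNormedType.Exports.

Local Open Scope classical_set_scope.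
Local Open Scope ring_scope.

Section sequences_of_random_variables.
Context {d : measure_display} {Omega : measurableType d} {R : realType}.
Variables (P : probability Omega R) (xi : nat -> {RV P >-> measurableTypeR R}).

Definition exchangeable : Prop :=
  forall (n : nat) (s : 'S_n) (B : set (n.-tuple (measurableTypeR R))),
    measurable B ->
    pushforward P (fun w => [tuple xi i w | i < n]) B =
    pushforward P (fun w => [tuple xi (s i) w | i < n]) B.

Definition finite_moments : Prop :=
  forall i k : nat, P.-integrable setT (fun w => (xi i w ^+ k)%:E).

End sequences_of_random_variables.

Section probability_measures_on_the_line.
Variable R : realType.

Definition M1 : Type := probability (measurableTypeR R) R.

Definition bounded_continuous (f : R -> R) : Prop :=
  continuous f /\ bounded_fun f.

(* The topology of weak convergence is the coarsest one for which
   [lambda |-> \int f dlambda] is continuous for every bounded continuous [f],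
   i.e. the initial topology of the evaluation into a product of copies of
   the real line. *)
Definition weak_eval (lambda : M1) :
    prod_topology (fun _ : {f : R -> R | bounded_continuous f} => R) :=
  fun f => \int[lambda]_x sval f x.

Definition M1_borel : set (set M1) :=
  <<s (open : set (set (initial_topology weak_eval))) >>.

Definition real_sequences : measurableType _ :=
  g_sigma_algebraType
    (\bigcup_(i : nat) preimage_set_system setT
       (fun x : nat -> measurableTypeR R => x i) measurable).

(* [Q] is the product of countably many copies of [lambda]; the values on the
   cylinders (a generating pi-system) determine [Q]. *)
Definition is_infinite_product (lambda : M1)
    (Q : probability real_sequences R) : Prop :=
  forall (n : nat) (A : nat -> set (measurableTypeR R)),
    (forall i, measurable (A i)) ->
    Q [set x | forall i, (i < n)%N -> A i (x i)] =
    (\prod_(i < n) lambda (A i))%E.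

Definition moment (lambda : M1) (k : nat) : R := \int[lambda]_x (x ^+ k).

Definition variance_of (lambda : M1) : R :=
  moment lambda 2 - moment lambda 1 ^+ 2.

End probability_measures_on_the_line.

Record de_finetti_representation {d : measure_display}
    {Omega : measurableType d} {R : realType} (P : probability Omega R)
    (xi : nat -> {RV P >-> measurableTypeR R})
    {d' : measure_display} {T : measurableType d'} (mu : probability T R)
    (Lambda : T -> M1 R) : Prop := {
  directing_measurable :
    forall U : set (M1 R), M1_borel U -> measurable (Lambda @^-1` U) ;
  directing_mixture :
    exists P_ : T -> probability (real_sequences R) R,
      (forall t, is_infinite_product (Lambda t) (P_ t)) /\
      forall F : set (real_sequences R), measurable F ->
        P [set w | F (fun i => xi i w)] = (\int[mu]_t P_ t F)%E ;
  directing_moments :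
    forall (t : T) (k : nat),
      (Lambda t).-integrable setT (fun x => (x ^+ k)%:E) }.

Section semicircle.
Context {R : realType}.
Implicit Types v x : R.

Definition semicircle_pdf v x : R :=
  (2 * pi * v)^-1 * Num.sqrt (Num.max (4 * v - x ^+ 2) 0).

(* Only [0 <= v] is meaningful; for [v < 0] this is the zero measure. *)
Definition semicircle v : set (measurableTypeR R) -> \bar R := fun A =>
  if v == 0 then \d_(0 : measurableTypeR R) A
  else (\int[lebesgue_measure]_(x in A) (semicircle_pdf v x)%:E)%E.

Lemma semicircle_pdf_ge0 v x : 0 <= semicircle_pdf v x.
Proof.
rewrite /semicircle_pdf; have [v0|v0] := leP 0 v.
  by rewrite mulr_ge0 ?sqrtr_ge0// invr_ge0 !mulr_ge0// pi_ge0.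
rewrite max_r ?sqrtr0 ?mulr0// subr_le0.
by rewrite (@le_trans _ _ 0) ?sqr_ge0// mulr_ge0_le0 ?ltW.
Qed.

Lemma measurable_semicircle_pdf v :
  measurable_fun [set: measurableTypeR R] (semicircle_pdf v).
Proof.
apply: measurable_funM => //; apply: measurableT_comp => //.
  exact: continuous_measurable_fun (@sqrt_continuous R).
apply: measurable_maxr => //; apply: measurable_funB => //.
Qed.

Let semicircle0 v : semicircle v set0 = 0%E.
Proof. by rewrite /semicircle; case: ifP; rewrite ?measure0 ?integral_set0. Qed.

Let semicircle_ge0 v A : (0 <= semicircle v A)%E.
Proof.
rewrite /semicircle; case: ifP => // _; apply: integral_ge0 => x _.
by rewrite lee_fin semicircle_pdf_ge0.
Qed.

Let semicircle_sigma_additive v : semi_sigma_additive (semicircle v).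
Proof.
rewrite /semicircle; case: (v == 0).
  exact: measure_semi_sigma_additive.
move=> /= F mF tF mUF; apply: cvg_toP.
  apply: ereal_nondecreasing_is_cvgn => m n mn.
  apply: lee_sum_nneg_natr => // k _ _.
  by apply: integral_ge0 => /= x _; rewrite lee_fin semicircle_pdf_ge0.
rewrite ge0_integral_bigcup//=.
- by apply/measurable_funTS/measurable_EFinP; exact: measurable_semicircle_pdf.
- by move=> x _; rewrite lee_fin semicircle_pdf_ge0.
Qed.

HB.instance Definition _ v := isMeasure.Build _ _ _ (semicircle v)
  (semicircle0 v) (semicircle_ge0 v) (@semicircle_sigma_additive v).

End semicircle.

Definition is_semicircle_mixture {R : realType} {d : measure_display}
    {T : measurableType d} (mu : probability T R) (v : T -> R)
    (sigma : M1 R) : Prop :=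
  forall f : R -> R, bounded_continuous f ->
    \int[sigma]_x f x = \int[mu]_t \int[semicircle (v t)]_x f x.

(* Main.v *)
Require Import Defs.
From HB Require Import structures.
From mathcomp Require Import all_boot all_order all_algebra.
From mathcomp Require Import all_classical all_reals all_analysis.
From mathcomp Require Import measurable_realfun ring lra.

Set Implicit Arguments.
Unset Strict Implicit.
Unset Printing Implicit Defensive.

Import Order.TTheory GRing.Theory Num.Theory.
Import numFieldNormedType.Exports.

Local Open Scope classical_set_scope.
Local Open Scope ring_scope.

(* For [v > 0] the law [semicircle v] is the image of [semicircle 1] under
   multiplication by [sqrt v], so its [2k]-th moment is [v ^ k * M_k] with
   [0 < M_k < +oo].  If the mixture is [semicircle s], comparing the second and
   the fourth moments gives that [v] has mean [s] and second moment [s ^ 2]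
   under [mu], hence variance zero.  The converse holds because a finite measure
   on the line is determined by the integrals of bounded continuous
   functions. *)

(** * Lebesgue measure under dilations *)

Section lebesgue_scaling.
Context {R : realType}.
Notation mu := (@lebesgue_measure R).
Notation scale c := ( *%R c : measurableTypeR R -> measurableTypeR R).

Lemma measurable_scale (c : R) : measurable_fun setT (scale c).
Proof. exact: mulrl_measurable. Qed.

(** Both sides are measures in [A], and Lebesgue measure is determined by its values on half-open
    intervals, where the claim is a computation of lengths. *)
Lemma lebesgue_measure_scale (c : R) (A : set (measurableTypeR R)) :
  0 < c -> measurable A -> mu A = (c%:E * mu (scale c @^-1` A))%E.
Proof.
move=> c0 mA; have mc := measurable_scale c.
pose nu := mscale (NngNum (ltW c0)) (pushforward mu (scale c)).
rewrite -[RHS]/(nu mc A); apply: lebesgue_measure_unique => // _ [[a b]] _ <-.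
rewrite [RHS](_ : _ = c%:E * mu `](a / c)%R, (b / c)%R])%E; last first.
  congr (_ * mu _)%E.
  apply/seteqP; split => x /=;
    by rewrite !in_itv/= ltr_pdivrMr// ler_pdivlMr// mulrC.
rewrite !lebesgue_measure_itv/= !lte_fin ltr_pM2r ?invr_gt0//.
case: ifP => _; last by rewrite mule0.
by rewrite -!EFinB -EFinM -mulrBl mulrCA divff ?mulr1// gt_eqF.
Qed.

Lemma ge0_integral_scale (c : R) (G : R -> \bar R) : 0 < c ->
  measurable_fun [set: measurableTypeR R] G -> (forall x, 0 <= G x)%E ->
  (\int[mu]_x G x = c%:E * \int[mu]_x G (c * x)%R)%E.
Proof.
move=> c0 mG G0; have mc := measurable_scale c.
pose nu := mscale (NngNum (ltW c0)) (pushforward mu (scale c)).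
rewrite (eq_measure_integral (nu mc)).
  by rewrite ge0_integral_mscale//= ge0_integral_pushforward.
by move=> A mA _; exact: lebesgue_measure_scale.
Qed.

End lebesgue_scaling.

(** * Scaling, support and even moments of the semicircle laws *)

Section semicircle_scaling.
Context {R : realType}.
Notation mu := (@lebesgue_measure R).
Notation scale c := ( *%R c : measurableTypeR R -> measurableTypeR R).
Notation semicircle1 := (@semicircle R 1%R).
Implicit Types v : R.

(** The radicand is homogeneous: a factor [v] leaves the maximum, and its root together with the
    Jacobian [Num.sqrt v] cancels the [v] of the normalisation. *)
Lemma semicircle_pdf_scale v x : 0 < v ->
  Num.sqrt v * semicircle_pdf v (Num.sqrt v * x) = semicircle_pdf 1 x.
Proof.
move=> v0; rewrite /semicircle_pdf exprMn sqr_sqrtr ?ltW// !mulr1.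
have -> : Num.max (4 * v - v * x ^+ 2) 0 = v * Num.max (4 - x ^+ 2) 0.
  by rewrite maxr_pMr ?ltW// mulr0 mulrBr (mulrC v 4).
rewrite sqrtrM ?ltW// mulrCA (mulrA (Num.sqrt v)) -expr2 sqr_sqrtr ?ltW//.
rewrite mulrA; congr (_ * _).
by rewrite (invfM (2 * pi)) -mulrA mulVf ?mulr1 ?gt_eqF.
Qed.

(** Change of variables in the density, with Jacobian [Num.sqrt v]. *)
Lemma semicircle_preimage v (A : set (measurableTypeR R)) :
  0 < v -> measurable A ->
  semicircle v A = semicircle 1 (( *%R (Num.sqrt v)) @^-1` A).
Proof.
move=> v0 mA; rewrite /semicircle gt_eqF// oner_eq0 integral_mkcond.
have sv0 : 0 < Num.sqrt v by rewrite sqrtr_gt0.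
(* Extending the density by zero outside [A] makes the dilation formula for integrals over the whole
   line applicable. *)
pose G := (fun x => (semicircle_pdf v x)%:E) \_ A; rewrite -/G.
have mG : measurable_fun [set: measurableTypeR R] G.
  apply/(measurable_restrictT _ _).1 => //.
  apply/measurable_EFinP/measurable_funTS.
  exact: measurable_semicircle_pdf.
have G0 x : (0 <= G x)%E.
  by apply: erestrict_ge0 => y _; rewrite lee_fin semicircle_pdf_ge0.
rewrite (ge0_integral_scale sv0)// -ge0_integralZl//=.
- rewrite [RHS]integral_mkcond; apply: eq_integral => x _.
  rewrite /G /patch; case: (pselect (A (Num.sqrt v * x))) => Ax.
    by rewrite !mem_set// -EFinM semicircle_pdf_scale.
  by rewrite !memNset// mule0.
exact: (measurableT_comp mG (measurable_scale _)).
Qed.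

Lemma semicircle0 (A : set (measurableTypeR R)) :
  semicircle 0 A = \d_(0 : measurableTypeR R) A.
Proof. by rewrite /semicircle eqxx. Qed.

(* At [v = 0] the two sides differ by the total mass of [semicircle 1], which
   is not computed here: hence the condition [F 0 = 0]. *)
Lemma ge0_integral_semicircle v (F : R -> \bar R) : 0 <= v ->
  measurable_fun [set: measurableTypeR R] F -> (forall x, 0 <= F x)%E ->
  0 < v \/ F 0 = 0%E ->
  (\int[semicircle v]_x F x = \int[semicircle1]_x F (Num.sqrt v * x)%R)%E.
Proof.
rewrite le_eqVlt => /predU1P[<- mF F0|v0 mF F0 _].
  move=> [|F00]; first by move=> v0; exfalso; move: v0; rewrite ltxx.
  rewrite sqrtr0.
  rewrite [RHS]integral0_eq => [|x _]; last by rewrite mul0r.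
  rewrite (eq_measure_integral (\d_(0 : measurableTypeR R))).
    by rewrite integral_dirac// F00 mule0.
  by move=> A mA _; exact: semicircle0.
have ms := measurable_scale (Num.sqrt v).
pose nu := pushforward (semicircle 1) (scale (Num.sqrt v))
  : {measure set (measurableTypeR R) -> \bar R}.
rewrite (eq_measure_integral (nu ms)).
  by rewrite ge0_integral_pushforward.
by move=> A mA _; exact: semicircle_preimage.
Qed.

Lemma semicircle1_support : semicircle 1 (~` (`[-2, 2] : set R)) = 0%E.
Proof.
rewrite /semicircle oner_eq0 integral0_eq// => x /= /negP.
rewrite in_itv/= => x2; congr EFin.
rewrite /semicircle_pdf max_r ?sqrtr0 ?mulr0// mulr1 subr_le0.
move: x2; rewrite negb_and -!ltNge => /orP[] x2; nra.
Qed.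

(** On the support [[-2, 2]] the density is at most 1, since the root is at most 2 and [pi >= 2]. *)
Lemma semicircle1_lty : (semicircle 1 [set: R] < +oo)%E.
Proof.
rewrite -(setUv `[-2, 2]%classic) measureU0//=; last 2 first.
- exact: measurableC.
- exact: semicircle1_support.
rewrite /semicircle oner_eq0.
rewrite (@le_lt_trans _ _ (\int[mu]_(x in `[(-2)%R, 2%R]) 1)%E)//.
  apply: ge0_le_integral => //.
  - by move=> x _; rewrite lee_fin semicircle_pdf_ge0.
  - apply/measurable_EFinP/measurable_funTS.
    exact: measurable_semicircle_pdf.
  - move=> x _; rewrite lee_fin /semicircle_pdf !mulr1.
    rewrite ler_pdivrMl ?mulr_gt0 ?pi_gt0//.
    have : Num.sqrt (Num.max (4 - x ^+ 2) 0) <= Num.sqrt (2 ^+ 2).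
      rewrite ler_sqrt ?ge_max//; nra.
    rewrite sqrtr_sqr ger0_norm//; have := pi_ge2 R; nra.
rewrite integral_cst//= mul1e lebesgue_measure_itv/= lte_fin.
by case: ifP; rewrite ?ltry.
Qed.

(** On this interval [4 - x ^+ 2 >= 1], so the density is at least [(2 * pi)^-1]. The interval stays
    away from 0, so that even powers are bounded below on it as well. *)
Lemma semicircle1_itv_gt0 : (0 < semicircle (1 : R)%R `[(2^-1)%R, 1%R])%E.
Proof.
rewrite /semicircle oner_eq0.
rewrite (@lt_le_trans _ _
  (\int[mu]_(x in `[(2^-1)%R, 1%R]) ((2 * pi)^-1)%R%:E)%E)//.
  rewrite integral_cst//= lebesgue_measure_itv/= lte_fin ifT; last by lra.
  by rewrite -EFinB -EFinM lte_fin mulr_gt0 ?invr_gt0 ?mulr_gt0 ?pi_gt0//; lra.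
apply: ge0_le_integral => //.
- by move=> x _; rewrite lee_fin invr_ge0 mulr_ge0 ?pi_ge0.
- apply/measurable_EFinP/measurable_funTS.
    exact: measurable_semicircle_pdf.
- move=> x /=; rewrite in_itv/= => /andP[x1 x2].
  rewrite lee_fin /semicircle_pdf !mulr1 ler_peMr ?invr_ge0 ?mulr_ge0 ?pi_ge0//.
  rewrite -{1}sqrtr1 ler_sqrt ?le_max; nra.
Qed.

Lemma semicircle_lty v : (semicircle v [set: R] < +oo)%E.
Proof.
have [v0|v0|->] := ltgtP v 0; last by rewrite semicircle0 diracT ltry.
(* For [v < 0] the radicand is negative everywhere; covering this case lets the finite measure
   structure be declared for every [v]. *)
- rewrite /semicircle lt_eqF// integral0_eq// => x _; congr EFin.
  by rewrite /semicircle_pdf max_r ?sqrtr0 ?mulr0//; nra.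
- by rewrite semicircle_preimage// preimage_setT semicircle1_lty.
Qed.

Lemma measurable_exprn_EFin k :
  measurable_fun [set: measurableTypeR R] (fun x : R => (x ^+ k)%:E).
Proof. exact/measurable_EFinP/measurable_funX. Qed.

(** Compact support: only [[-2, 2]] contributes, and there the power is at most [4 ^+ k]. *)
Lemma semicircle1_even_moment_lty k :
  (\int[semicircle1]_x (x ^+ k.*2)%R%:E < +oo)%E.
Proof.
rewrite (@ge0_negligible_integral _ _ _ semicircle1 _
  (~` (`[-2, 2]%classic : set R)))//; last 4 first.
- exact: measurableC.
- exact: measurable_exprn_EFin.
- by move=> x _; rewrite lee_fin -mul2n exprM exprn_ge0// sqr_ge0.
- exact: semicircle1_support.
rewrite setTD setCK.
apply: (@le_lt_trans _ _
    (\int[semicircle1]_(x in `[(-2)%R, 2%R]) (4 ^+ k)%R%:E)%E).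
  apply: ge0_le_integral => //.
  - by move=> x _; rewrite lee_fin -mul2n exprM exprn_ge0// sqr_ge0.
  - by apply: measurable_funTS; exact: measurable_exprn_EFin.
  - move=> x /=; rewrite in_itv/= => /andP[x1 x2].
    by rewrite lee_fin -mul2n exprM lerXn2r ?nnegrE ?sqr_ge0//; nra.
rewrite integral_cst//= lte_mul_pinfty ?lee_fin ?exprn_ge0//.
by rewrite (le_lt_trans _ semicircle1_lty)// le_measure ?inE.
Qed.

(** An interval of positive mass on which [x ^+ 2 >= 4^-1] already gives a positive contribution. *)
Lemma semicircle1_even_moment_gt0 k :
  (0 < \int[semicircle1]_x (x ^+ k.*2)%R%:E)%E.
Proof.
apply: (@lt_le_trans _ _
    (\int[semicircle1]_(x in `[(2^-1)%R, 1%R]) (4^-1 ^+ k)%R%:E)%E).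
  rewrite integral_cst//= mule_gt0 ?lte_fin ?exprn_gt0 ?invr_gt0//.
  exact: semicircle1_itv_gt0.
apply: (@le_trans _ _
    (\int[semicircle1]_(x in `[(2^-1)%R, 1%R]) (x ^+ k.*2)%R%:E)%E).
  apply: ge0_le_integral => //.
  - by apply: measurable_funTS; exact: measurable_exprn_EFin.
  - move=> x /=; rewrite in_itv/= => /andP[x1 x2].
    by rewrite lee_fin -mul2n exprM lerXn2r ?nnegrE ?invr_ge0 ?sqr_ge0//; nra.
apply: ge0_subset_integral => //.
- exact: measurable_exprn_EFin.
- by move=> x _; rewrite lee_fin -mul2n exprM exprn_ge0// sqr_ge0.
Qed.

(** The exponent is a successor so that the power vanishes at 0, which makes the scaling formula
    valid at [v = 0] too. *)
Lemma semicircle_even_moment v k : 0 <= v ->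
  (\int[semicircle v]_x (x ^+ k.+1.*2)%R%:E =
   (v ^+ k.+1)%R%:E * \int[semicircle1]_x (x ^+ k.+1.*2)%R%:E)%E.
Proof.
move=> v0; rewrite ge0_integral_semicircle//; last 3 first.
- exact: measurable_exprn_EFin.
- by move=> x; rewrite lee_fin -mul2n exprM exprn_ge0// sqr_ge0.
- by right; rewrite doubleS expr0n.
rewrite -ge0_integralZl//.
- apply: eq_integral => x _.
  by rewrite -EFinM exprMn -(mul2n k.+1) (exprM (Num.sqrt v)) sqr_sqrtr.
- exact: measurable_exprn_EFin.
- by move=> x _; rewrite lee_fin -mul2n exprM exprn_ge0// sqr_ge0.
- by rewrite lee_fin exprn_ge0.
Qed.

End semicircle_scaling.

Lemma semicircle_fin_num (R : realType) (v : R) : fin_num_fun (@semicircle R v).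
Proof. by apply: lty_fin_num_fun; exact: semicircle_lty. Qed.

HB.instance Definition _ (R : realType) (v : R) := @Measure_isFinite.Build _
  (measurableTypeR R) R (@semicircle R v) (@semicircle_fin_num R v).

(** * The mixture identity, from bounded to nonnegative continuous functions *)

Section semicircle_mixture.
Context {R : realType} {d : measure_display} {T : measurableType d}.
Variables (mu : probability T R) (v : T -> R).
Hypotheses (mv : measurable_fun setT v) (v0 : forall t, 0 <= v t).

(** Scaling moves the parameter [t] from the measure into the integrand, so that Tonelli's theorem
    for the fixed law [semicircle 1] applies. The points with [v t = 0] are split off, the integral
    being [F 0] there. *)
Lemma measurable_integral_semicircle (F : R -> \bar R) :
  measurable_fun [set: measurableTypeR R] F -> (forall x, 0 <= F x)%E ->
  measurable_fun setT (fun t => \int[semicircle (v t)]_x F x)%E.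
Proof.
move=> mF F0.
have -> : (fun t => \int[semicircle (v t)]_x F x)%E =
    (fun t => if (v t == 0)%R then F 0%R
              else \int[@semicircle R 1]_x F (Num.sqrt (v t) * x)%R)%E.
  apply/funext => t; case: ifPn => [/eqP ->|vt0].
    rewrite (eq_measure_integral (\d_(0 : measurableTypeR R))).
      by rewrite integral_dirac// diracT mul1e.
    by move=> A mA _; exact: semicircle0.
  by rewrite ge0_integral_semicircle//; left; rewrite lt_neqAle eq_sym vt0 v0.
apply: measurable_fun_ifT => //.
  exact: measurable_fun_eqr.
pose f (z : T * measurableTypeR R) := F (Num.sqrt (v z.1) * z.2).
apply: (@measurable_fun_fubini_tonelli_F _ _ _ _ _ (@semicircle R 1) f) => //.
- apply: (measurableT_comp mF); apply: measurable_funM => //.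
  apply: measurableT_comp.
    exact: continuous_measurable_fun (@sqrt_continuous R).
  exact: measurableT_comp.
- by move=> z; exact: F0.
Qed.

(** A bound uniform in [t]: the sum dominates both the Dirac mass and the mass common to all
    positive variances. *)
Lemma semicircle_mass_le t :
  (semicircle (v t) [set: R] <= 1 + @semicircle R 1 [set: R])%E.
Proof.
have := v0 t; rewrite le_eqVlt => /predU1P[<-|vt].
  by rewrite semicircle0 diracT leeDl.
by rewrite semicircle_preimage// preimage_setT leeDr.
Qed.

Variable sigma : M1 R.
Hypothesis sigmaE : is_semicircle_mixture mu v sigma.

(** The hypothesis on [sigma] concerns real-valued integrals, that is [fine] of extended ones.
    Boundedness of [F] makes all of them finite, so that [fine] can be removed. *)
Lemma bounded_semicircle_mixture (F : R -> R) (M : R) : continuous F ->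
  (forall x, 0 <= F x) -> (forall x, F x <= M) ->
  (\int[sigma]_x (F x)%:E = \int[mu]_t \int[semicircle (v t)]_x (F x)%:E)%E.
Proof.
move=> cF F0 FM.
have mF : measurable_fun [set: measurableTypeR R] (EFin \o F).
  by apply/measurable_EFinP; exact: continuous_measurable_fun.
have M0 : 0 <= M := le_trans (F0 0) (FM 0).
have bF : bounded_continuous F.
  split => //; exists M; split; first exact: num_real.
  by move=> y My x _ /=; rewrite ger0_norm// (le_trans (FM x))// ltW.
have bound (m : {measure set (measurableTypeR R) -> \bar R}) :
    (\int[m]_x (F x)%:E <= M%:E * m [set: R])%E.
  rewrite -integral_cst//; apply: ge0_le_integral => //.
  - by move=> x _; rewrite lee_fin.
  - by move=> x _; rewrite lee_fin.
have finF (m : {finite_measure set (measurableTypeR R) -> \bar R}) :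
    (\int[m]_x (F x)%:E \is a fin_num)%E.
  rewrite ge0_fin_numE ?integral_ge0// => [|x _]; last by rewrite lee_fin.
  rewrite (le_lt_trans (bound m))// lte_mul_pinfty//.
  by rewrite -ge0_fin_numE// fin_num_measure.
have := sigmaE bF; rewrite /Rintegral.
under [in RHS]eq_integral => t _ do rewrite (fineK (finF (semicircle (v t)))).
move=> e; rewrite -(fineK (finF sigma)) e fineK//.
rewrite ge0_fin_numE; last first.
  by apply: integral_ge0 => t _; apply: integral_ge0 => x _; rewrite lee_fin.
(* The outer integral is finite because the inner ones are bounded uniformly in [t]. *)
apply: (@le_lt_trans _ _
    (\int[mu]_t (M%:E * (1 + @semicircle R 1 [set: R])))%E).
  apply: ge0_le_integral => //.
  - by move=> t _; apply: integral_ge0 => x _; rewrite lee_fin.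
  - by apply: measurable_integral_semicircle => // x; rewrite lee_fin.
  - move=> t _; apply: (le_trans (bound _)).
    by apply: lee_wpmul2l; [rewrite lee_fin|exact: semicircle_mass_le].
rewrite integral_cst//= probability_setT mule1 lte_mul_pinfty//.
by rewrite lte_add_pinfty ?ltry// semicircle1_lty.
Qed.

Lemma cvg_min_nat (x : R) : (Num.min x n%:R)%:E @[n --> \oo] --> x%:E.
Proof.
apply: cvg_near_cst; near=> n; rewrite /= min_l//.
near: n; exact: nbhs_infty_ger.
Unshelve. all: end_near. Qed.

(** Truncation at height [n] reduces to the bounded case; monotone convergence is then applied under
    [sigma], under each semicircle law and under [mu]. This makes even powers admissible test
    functions. *)
Lemma ge0_semicircle_mixture (F : R -> R) :
  continuous F -> (forall x, 0 <= F x) ->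
  (\int[sigma]_x (F x)%:E = \int[mu]_t \int[semicircle (v t)]_x (F x)%:E)%E.
Proof.
move=> cF F0.
pose Fn n x := Num.min (F x) n%:R.
have cFn n : continuous (Fn n).
  move=> x; apply: (@continuous_min _ _ F (cst n%:R)); first exact: cF.
  exact: cst_continuous.
have Fn0 n x : 0 <= Fn n x by rewrite le_min F0/=.
have mFn n : measurable_fun [set: measurableTypeR R] (EFin \o Fn n).
  by apply/measurable_EFinP; exact: continuous_measurable_fun.
have ndF x : {homo (fun n => (Fn n x)%:E) : n m / (n <= m)%N >-> (n <= m)%E}.
  by move=> n m nm; rewrite lee_fin le_min2// ler_nat.
have FE (m : {measure set (measurableTypeR R) -> \bar R}) :
    (\int[m]_x (F x)%:E)%E = limn (fun n => \int[m]_x (Fn n x)%:E)%E.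
  rewrite -monotone_convergence//.
  - by apply: eq_integral => x _; apply/esym/cvg_lim => //; exact: cvg_min_nat.
  - by move=> n x _; rewrite lee_fin.
rewrite FE; under [RHS]eq_integral do rewrite FE.
rewrite monotone_convergence//.
- apply: congr_lim; apply/funext => n.
  apply: (@bounded_semicircle_mixture _ n%:R) => // x.
  by rewrite /Fn ge_min lexx orbT.
- move=> n; apply: (measurable_integral_semicircle (mFn n)) => x.
  by rewrite lee_fin.
- by move=> n t _; apply: integral_ge0 => x _; rewrite lee_fin.
- move=> t _ n m nm; apply: ge0_le_integral => [//|x _|||x _].
  + by rewrite lee_fin.
  + exact: mFn.
  + exact: mFn.
  + exact: ndF.
Qed.

End semicircle_mixture.

(** * Measurability and nonnegativity of the directing variances *)

Section directing_moments.
Context {R : realType} {d : measure_display} {T : measurableType d}.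
Variable Lambda : T -> M1 R.
Hypothesis mLambda :
  forall U : set (M1 R), M1_borel U -> measurable (Lambda @^-1` U).

(** Integration of [f] is one coordinate of [weak_eval], so the preimage of an open interval is
    weakly open. *)
Lemma measurable_Rintegral_directing (f : R -> R) : bounded_continuous f ->
  measurable_fun setT (fun t => \int[Lambda t]_x f x).
Proof.
move=> bf mD.
apply: (measurability _ (RGenOpens.measurableE R)) => // _ [_ [a [b ->]] <-].
rewrite setTI.
pose fb : {f : R -> R | bounded_continuous f} := exist _ f bf.
pose W := (fun g : prod_topology
  (fun _ : {f : R -> R | bounded_continuous f} => R) => g fb) @^-1` `]a, b[.
have oW : open W.
  by apply: open_comp; [move=> g _|exact: interval_open];
    exact: (@proj_continuous {classic {f : R -> R | bounded_continuous f}}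
      (fun=> R : topologicalType) fb g).
have : M1_borel (@weak_eval R @^-1` W).
  by apply: sub_sigma_algebra; exists W.
exact: mLambda.
Qed.

Hypothesis iLambda : forall (t : T) (k : nat),
  (Lambda t).-integrable setT (fun x => (x ^+ k)%:E).

Let clamp n (y : R) := Num.max (- n%:R) (Num.min y n%:R).

(** Powers are unbounded, so they are clamped to [[- n, n]], on both sides because odd powers change
    sign. By dominated convergence, with [|x ^+ k|] dominating, the moment is a pointwise limit of
    measurable functions of [t]. *)
Lemma measurable_moment k :
  measurable_fun setT (fun t => moment (Lambda t) k).
Proof.
have cc n : continuous (fun x : R => clamp n (x ^+ k)).
  move=> x; apply: (@continuous_max _ _ (cst (- n%:R))
    (fun x : R => Num.min (x ^+ k) n%:R)).
    exact: cst_continuous.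
  apply: (@continuous_min _ _ (fun x : R => x ^+ k) (cst n%:R)).
    exact: exprn_continuous.
  exact: cst_continuous.
apply: (@measurable_fun_cvg _ _ _ _
  (fun n t => \int[Lambda t]_x clamp n (x ^+ k))).
- move=> n; apply: measurable_Rintegral_directing; split => //.
  exists n%:R; split; first exact: num_real.
  move=> y ny x _ /=; rewrite (le_trans _ (ltW ny))// /clamp ler_norml.
  rewrite le_max lexx/= ge_max ge_min lexx orbT andbT.
  by rewrite (@le_trans _ _ 0)// oppr_le0.
- move=> t _; rewrite /moment /Rintegral.
  have [] // := @dominated_convergence _ _ _ (Lambda t) setT measurableT
    (fun n x => (clamp n (x ^+ k))%:E) (fun x => (x ^+ k)%:E)
    (fun x => `|(x ^+ k)%:E|%E).
  + by move=> n; apply/measurable_EFinP; exact: continuous_measurable_fun.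
  + exact: measurable_exprn_EFin.
  + apply: aeW => x _; apply: cvg_near_cst; near=> n.
    have : `|x ^+ k| <= n%:R by near: n; exact: nbhs_infty_ger.
    rewrite ler_norml => /andP[h1 h2].
    by rewrite /clamp min_l// max_r.
  + exact: (integrable_abse (iLambda t k)).
  + apply: aeW => x n _; rewrite /= lee_fin /clamp ler_norml.
    have yl := ler_norm (x ^+ k); have := ler_norm (- x ^+ k).
    rewrite normrN le_max ge_max => yr; have n0 := ler0n R n.
    by case: (leP (x ^+ k) n%:R) => h; apply/andP; split;
      [apply/orP; right|apply/andP; split|apply/orP; right|
       apply/andP; split]; lra.
  + move=> _ _ h; apply: fine_cvg.
    rewrite fineK//.
    exact: (integrable_fin_num measurableT (iLambda t k)).
Unshelve. all: end_near. Qed.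

Lemma measurable_variance :
  measurable_fun setT (fun t => variance_of (Lambda t)).
Proof.
by apply: measurable_funB; [|apply: measurable_funX]; exact: measurable_moment.
Qed.

Lemma variance_ge0 t : 0 <= variance_of (Lambda t).
Proof.
set m1 := moment (Lambda t) 1.
have i1 := iLambda t 1; have i2 := iLambda t 2.
have ic c : (Lambda t).-integrable setT (fun x => c%:E).
  exact: finite_measure_integrable_cst.
have iz : (Lambda t).-integrable setT (fun x => (- (2 * m1) * x ^+ 1)%:E).
  under eq_fun do rewrite EFinM.
  exact: integrableZl.
(* The integrand is [(x - m1) ^+ 2], expanded into terms whose integrals are moments. *)
have : 0 <= \int[Lambda t]_x ((x ^+ 2 + (- (2 * m1) * x ^+ 1 + m1 ^+ 2))).
  apply: Rintegral_ge0 => x _; rewrite expr1.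
  by have := sqr_ge0 (x - m1); nra.
rewrite RintegralD//; last first.
  exact: (integrableD measurableT iz (ic _)).
rewrite RintegralD//; last exact: ic.
rewrite (_ : \int[Lambda t]_x (- (2 * m1) * x ^+ 1) = - (2 * m1) * m1);
  last first.
  exact: RintegralZl.
rewrite (_ : \int[Lambda t]__ m1 ^+ 2 = m1 ^+ 2); last first.
  rewrite Rintegral_cst// -[RHS]mulr1; congr (_ * _).
  exact: (congr1 fine (@probability_setT _ _ _ (Lambda t))).
rewrite -/(moment _ 2) /variance_of -/m1.
nra.
Qed.

End directing_moments.

(** * Finite measures on the line are determined by bounded continuous functions *)

Section bounded_continuous_uniqueness.
Context {R : realType}.

(** A continuous ramp from 0 to 1 starting at [a], with slope [n]; it increases with [n] to the
    indicator of the open ray above [a]. *)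
Let tent (a : R) n (x : R) : R := Num.min 1 (n%:R * Num.max (x - a) 0).

Let tent_ge0 a n x : 0 <= tent a n x.
Proof. by rewrite /tent le_min ler01/= mulr_ge0// le_max lexx orbT. Qed.

Let continuous_tent a n : continuous (tent a n).
Proof.
move=> x; apply: (@continuous_min _ _ (cst 1)
  (fun x => n%:R * Num.max (x - a) 0)).
  exact: cst_continuous.
apply: cvgM; first exact: cvg_cst.
apply: (@continuous_max _ _ (fun x : R => x - a) (cst 0));
  last exact: cst_continuous.
by apply: cvgB; [exact: cvg_id|exact: cvg_cst].
Qed.

Let cvg_tent a x :
  (tent a n x)%:E @[n --> \oo] --> (\1_(`]a, +oo[%classic : set R) x)%:E.
Proof.
have [xa|ax] := leP x a.
  rewrite indicE memNset/=; last first.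
    by rewrite in_itv/= andbT; apply/negP; rewrite -leNgt.
  apply: cvg_near_cst; near=> n.
  by rewrite /tent (max_r (_ : x - a <= 0)) ?subr_le0// mulr0 min_r.
rewrite indicE mem_set/=; last by rewrite in_itv/= andbT.
apply: cvg_near_cst; near=> n.
(* The ramp has reached 1 at [x] as soon as [n >= (x - a)^-1]. *)
rewrite /tent max_l ?subr_ge0 ?ltW// min_l// -ler_pdivrMr ?subr_gt0//.
by near: n; exact: nbhs_infty_ger.
Unshelve. all: end_near. Qed.

(** Monotone convergence along the ramps gives equality on open rays, which form a generating
    pi-system. *)
Lemma eq_measure_bounded_continuous
    (m1 m2 : {finite_measure set (measurableTypeR R) -> \bar R}) :
  (forall F : R -> R, continuous F -> (forall x, 0 <= F x) ->
    (forall x, F x <= 1) ->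
    (\int[m1]_x (F x)%:E = \int[m2]_x (F x)%:E)%E) ->
  forall A, measurable A -> m1 A = m2 A.
Proof.
move=> m12 A mA.
have mt a n : measurable_fun [set: measurableTypeR R] (EFin \o tent a n).
  by apply/measurable_EFinP; exact: continuous_measurable_fun.
have rayE (m : {finite_measure set (measurableTypeR R) -> \bar R}) a :
    m `]a, +oo[%classic = limn (fun n => \int[m]_x (tent a n x)%:E)%E.
  rewrite -monotone_convergence//.
  - transitivity (\int[m]_x (\1_(`]a, +oo[%classic : set R) x)%:E)%E.
      by rewrite integral_indic// setIT.
    by apply: eq_integral => x _; apply/esym/cvg_lim => //; exact: cvg_tent.
  - by move=> n; exact: mt.
  - by move=> n x _; rewrite lee_fin.
  - move=> x _ n k nk; rewrite lee_fin /tent le_min2// ler_wpM2r ?ler_nat//.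
    by rewrite le_max lexx orbT.
(* The rays above [- n%:R] exhaust the line and have finite mass, as uniqueness on a pi-system
   requires. *)
apply: (@measure_unique _ R (measurableTypeR R) (@RGenOInfty.G R)
  (fun n => `](- n%:R), +oo[%classic) _ _ _ _ m1 m2) => //.
- exact: RGenOInfty.measurableE.
- move=> _ _ [a ->] [b ->]; exists (Num.max a b).
  by apply/seteqP; split => x /=; rewrite !in_itv/= !andbT gt_max => /andP.
- by move=> n; exists (- n%:R).
- apply/seteqP; split => // x _.
  have [n _ /(_ n (leqnn n)) /= nx] := nbhs_infty_gtr (- x).
  by exists n => //=; rewrite in_itv/= andbT ltrNl.
- move=> _ [a ->]; apply: (etrans (rayE m1 a) (etrans _ (esym (rayE m2 a)))).
  apply: congr_lim; apply/funext => n.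
  by apply: m12 => // x; rewrite /tent ge_min lexx.
- by move=> n; rewrite -ge0_fin_numE// fin_num_measure.
Qed.

End bounded_continuous_uniqueness.

(** * Semicircular mixtures and almost surely constant variances *)

Section semicircle_mixture_directing.
Context {R : realType} {d : measure_display} {T : measurableType d}.
Variables (mu : probability T R) (v : T -> R).
Hypotheses (mv : measurable_fun setT v) (v0 : forall t, 0 <= v t).
Variable sigma : M1 R.
Hypothesis sigmaE : is_semicircle_mixture mu v sigma.

(** The mass of the preimage is the integral of its indicator, which is almost everywhere the
    constant [\1_A s]. *)
Lemma ae_eq_cst_pushforward (s : R) : {ae mu, forall t, v t = s} ->
  forall A : set (measurableTypeR R), measurable A ->
  pushforward mu v A = \d_(s : measurableTypeR R) A.
Proof.
move=> vs A mA.
have mvA : measurable (v @^-1` A).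
  by rewrite -[X in measurable X]setTI; exact: mv.
transitivity (\int[mu]_t (\1_(v @^-1` A) t)%:E)%E.
  by rewrite integral_indic// setIT.
have e : ae_eq mu setT (fun t => (\1_(v @^-1` A) t)%:E)
    (cst (\1_A s)%:E : T -> \bar R).
  case: vs => N [mN N0 vsN]; exists N; split => //; apply: subset_trans vsN.
  by apply: subsetC; move=> t /= vts _; rewrite -vts !indicE.
rewrite (ge0_ae_eq_integral _ _ _ _ _ e)//.
- by rewrite integral_cst//= probability_setT mule1.
- by apply/measurable_EFinP; exact: measurable_indic.
- by move=> t _; rewrite lee_fin indicE.
Qed.

(** The moments of order [k.+1.*2] of both descriptions of [sigma] carry the same factor, a moment
    of [semicircle 1], which cancels because it is positive and finite. *)
Lemma mixture_moment (s : R) (k : nat) : 0 <= s ->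
  (forall A : set (measurableTypeR R), measurable A ->
    sigma A = semicircle s A) ->
  (\int[mu]_t (v t ^+ k.+1)%:E = (s ^+ k.+1)%:E)%E.
Proof.
move=> s0 sigmas.
have ev (x : R) : 0 <= x ^+ k.+1.*2 by rewrite -mul2n exprM exprn_ge0// sqr_ge0.
have := ge0_semicircle_mixture mv v0 sigmaE (@exprn_continuous _ k.+1.*2) ev.
rewrite (eq_measure_integral (@semicircle R s));
  last by move=> A mA _; exact: sigmas.
rewrite semicircle_even_moment//.
under [in RHS]eq_integral => t _ do rewrite semicircle_even_moment//.
rewrite ge0_integralZr//.
- have := @semicircle1_even_moment_gt0 R k.+1.
  have := @semicircle1_even_moment_lty R k.+1.
  case: (\int[_]_x _)%E => // M _ M0.
  (* An infinite integral of the power of [v] would remain infinite after multiplication by [M],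
     while the other side is finite. *)
  case: (\int[_]_t _)%E => [r||]; last 2 first.
  + by rewrite gt0_mulye.
  + by rewrite gt0_mulNye.
  by rewrite -!EFinM => -[/mulIf ->]//; rewrite gt_eqF// -lte_fin.
- apply/measurable_EFinP; exact: measurable_funX.
- by move=> t _; rewrite lee_fin exprn_ge0.
- exact/ltW/semicircle1_even_moment_gt0.
Qed.

(** With mean [s] and second moment [s ^+ 2], the integral of [(v t - s) ^+ 2] is zero, and so its
    integrand vanishes almost everywhere. *)
Lemma ae_eq_of_mixture_semicircle (s : R) : 0 <= s ->
  (forall A : set (measurableTypeR R), measurable A ->
    sigma A = semicircle s A) ->
  {ae mu, forall t, v t = s}.
Proof.
move=> s0 sigmas.
have int1 := mixture_moment 0 s0 sigmas.
have int2 := mixture_moment 1 s0 sigmas.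
have msq : measurable_fun setT (fun t => ((v t - s) ^+ 2)%:E).
  by apply/measurable_EFinP; apply: measurable_funX; exact: measurable_funB.
have mv1 : measurable_fun setT (fun t => (v t ^+ 1)%:E).
  by apply/measurable_EFinP; apply: measurable_funX.
have mv2 : measurable_fun setT (fun t => (v t ^+ 2)%:E).
  by apply/measurable_EFinP; apply: measurable_funX.
(* The square is expanded with all terms nonnegative on both sides, so that additivity of
   nonnegative integrals suffices and no extended reals are subtracted. *)
have e : (\int[mu]_t (((v t - s) ^+ 2)%:E + (2 * s)%:E * (v t ^+ 1)%:E) =
          \int[mu]_t ((v t ^+ 2)%:E + (s ^+ 2)%:E))%E.
  apply: eq_integral => t _; rewrite -EFinM -!EFinD; congr EFin; ring.
rewrite ge0_integralD// in e; last 3 first.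
- by move=> t _; rewrite lee_fin sqr_ge0.
- by move=> t _; rewrite mule_ge0 ?lee_fin ?mulr_ge0 ?exprn_ge0.
- exact: measurable_funeM.
rewrite ge0_integralZl// ?int1 in e; last 2 first.
- by move=> t _; rewrite lee_fin exprn_ge0.
- by rewrite lee_fin mulr_ge0.
rewrite ge0_integralD// ?int2 in e; last 2 first.
- by move=> t _; rewrite lee_fin sqr_ge0.
- by move=> t _; rewrite lee_fin sqr_ge0.
rewrite integral_cst//= probability_setT mule1 in e.
have sq0 : (\int[mu]_t `|((v t - s) ^+ 2)%:E| = 0)%E.
  under eq_integral => t _ do rewrite gee0_abs ?lee_fin ?sqr_ge0//.
  move: e; case: (\int[_]_t _)%E => // r; rewrite -!EFinM -!EFinD => -[e].
  congr EFin; nra.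
have /(ae_eq_integral_abs mu measurableT msq)[N [mN N0 vsN]] := sq0.
exists N; split => //; apply: subset_trans vsN.
apply: subsetC => t /= /(_ Logic.I) [] /eqP.
by rewrite sqrf_eq0 subr_eq0 => /eqP.
Qed.

(** Against each test function the inner integrals are almost everywhere constant in [t], so [sigma]
    and [semicircle a] have the same integrals, and uniqueness applies. *)
Lemma semicircle_of_ae_eq (a : R) : {ae mu, forall t, v t = a} ->
  forall A : set (measurableTypeR R), measurable A -> sigma A = semicircle a A.
Proof.
move=> va; apply: (eq_measure_bounded_continuous (m1 := sigma)
  (m2 := @semicircle R a)).
move=> F cF F0 F1; rewrite (ge0_semicircle_mixture mv v0 sigmaE cF F0).
have e : ae_eq mu setT (fun t => \int[semicircle (v t)]_x (F x)%:E)%E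
    (cst (\int[semicircle a]_x (F x)%:E)%E).
  case: va => N [mN N0 vaN]; exists N; split => //; apply: subset_trans vaN.
  by apply: subsetC => t /= -> _.
rewrite (ge0_ae_eq_integral _ _ _ _ _ e)//.
- by rewrite integral_cst//= probability_setT mule1.
- apply: (measurable_integral_semicircle mv v0 (F := EFin \o F)) => [|x].
    by apply/measurable_EFinP; exact: continuous_measurable_fun.
  by rewrite lee_fin.
- by move=> t _; apply: integral_ge0 => x _; rewrite lee_fin.
- by move=> t _; apply: integral_ge0 => x _; rewrite lee_fin.
Qed.

End semicircle_mixture_directing.

Theorem mainTheorem5 (R : realType)
  (d : measure_display) (Omega : measurableType d) (P : probability Omega R)
  (xi : nat -> {RV P >-> measurableTypeR R})
  (xi_exch : exchangeable xi) (xi_mom : finite_moments xi)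
  (d' : measure_display) (T : measurableType d') (mu : probability T R)
  (Lambda : T -> M1 R)
  (xi_repr : de_finetti_representation xi mu Lambda)
  (v : T -> R) (vE : forall t, v t = variance_of (Lambda t))
  (nu : set (measurableTypeR R) -> \bar R) (nuE : nu = pushforward mu v)
  (sigma : M1 R) (sigmaE : is_semicircle_mixture mu v sigma) :
  (exists s : R, 0 <= s /\
     forall A : set (measurableTypeR R), measurable A ->
       sigma A = semicircle s A) <->
  (exists a : R, 0 <= a /\
     forall A : set (measurableTypeR R), measurable A ->
       nu A = \d_(a : measurableTypeR R) A).
Proof.
have [mL _ iL] := xi_repr.
have mv : measurable_fun setT v.
  rewrite (_ : v = fun t => variance_of (Lambda t)); last exact/funext.
  exact: measurable_variance.
have v0 t : 0 <= v t by rewrite vE; exact: variance_ge0.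
split=> [[s [s0 sigmas]]|[a [a0 nua]]].
  exists s; split => // A mA; rewrite nuE; apply: ae_eq_cst_pushforward => //.
  exact: (ae_eq_of_mixture_semicircle mv v0 sigmaE).
exists a; split => //; apply: (semicircle_of_ae_eq mv v0 sigmaE).
(* The complement of the atom [a] is [nu]-null, so its preimage under [v] is a [mu]-null set outside
   which [v t = a]. *)
have ma : measurable (~` [set a] : set (measurableTypeR R)).
  exact: measurableC.
exists (v @^-1` (~` [set a])); split => //.
- by rewrite -[X in measurable X]setTI; exact: mv.
- have := nua _ ma; rewrite nuE /pushforward diracE memNset//.
  by apply.
Qed.
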